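(* Let $G$ and $H$ be two $t$-boundaried graphs with boundary $B=\{v_1,\dots,v_t\}$ (boundaries identified via labels). Then $G\equiv_{\mathrm{IS},t}H$ if and only if there exists a constant $c\in\mathbb{Z}$ such that $\mathfrak{s}_G(S)=\mathfrak{s}_H(S)+c$ for all $S\subseteq B$.
   Context: A $t$-boundaried graph is a finite simple undirected graph with an injective labeling $\lambda\colon\{1,\dots,t\}\to V$; the boundary is the set of labeled vertices, and boundaries of different $t$-boundaried graphs are identified via labels. The gluing $G\oplus F$ is obtained from the disjoint union by identifying equally labeled boundary vertices and removing parallel edges. $\mathrm{opt}_{\mathrm{IS}}$ is the maximum size of an independent set (of the underlying unboundaried graph). Two $t$-boundaried graphs $G,H$ satisfy $G\equiv_{\mathrm{IS},t}H$ if there is $\Delta\in\mathbb{Z}$ such that $\mathrm{opt}_{\mathrm{IS}}(G\oplus F)=\mathrm{opt}_{\mathrm{IS}}(H\oplus F)+\Delta$ for every $t$-boundaried graph $F$. For $S\subseteq B$, $\mathfrak{s}_G(S)$ is the maximum of $|X|$ over independent sets $X$ of $G$ with $X\cap B\subseteq S$. *)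

(* Defs.v *)
From HB Require Import structures.
From mathcomp Require Import all_boot all_order all_algebra.
Set Implicit Arguments.
Unset Strict Implicit.
Unset Printing Implicit Defensive.

Local Open Scope quotient_scope.

Record sgraph := SGraph {
  vertex :> finType;
  edge : rel vertex;
  edge_sym : symmetric edge;
  edge_irrefl : irreflexive edge
}.

(* The label set {1, ..., t} is 'I_t = {0, ..., t-1}. *)
Record bgraph (t : nat) := BGraph {
  underlying :> sgraph;
  label : 'I_t -> underlying;
  label_inj : injective label
}.

Section Independent.
Variable G : sgraph.

Definition independent (X : {set G}) : bool :=
  [forall x in X, forall y in X, ~~ edge x y].

Definition opt_IS : nat := \max_(X : {set G} | independent X) #|X|.

End Independent.

Section Gluing.
Variables (t : nat) (G F : bgraph t).

Definition union_edge (u v : G + F) : bool :=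
  match u, v with
  | inl x, inl y => edge x y
  | inr x, inr y => edge x y
  | _, _ => false
  end.

Definition same_label (x : G) (y : F) : bool :=
  [exists i : 'I_t, (x == label G i) && (y == label F i)].

Definition glued (u v : G + F) : bool :=
  match u, v with
  | inl x, inl x' => x == x'
  | inr y, inr y' => y == y'
  | inl x, inr y => same_label x y
  | inr y, inl x => same_label x y
  end.

Lemma same_labelP x y :
  reflect (exists2 i, x = label G i & y = label F i) (same_label x y).
Proof.
apply: (iffP existsP) => [[i /andP[/eqP -> /eqP ->]]|[i -> ->]]; exists i => //.
by rewrite !eqxx.
Qed.

Lemma glued_refl : reflexive glued.
Proof. by case=> x /=. Qed.

Lemma glued_sym : symmetric glued.
Proof. by case=> x [] y //=; rewrite eq_sym. Qed.

Lemma glued_trans : transitive glued.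
Proof.
move=> [y|y] [x|x] [z|z] //=.
- by move=> /eqP ->.
- by move=> /eqP ->.
- by move=> xy /eqP <-.
- move=> /same_labelP[i yi ->] /same_labelP[j yj ->].
  by rewrite (label_inj (etrans (esym yi) yj)).
- move=> /same_labelP[i -> yi] /same_labelP[j -> yj].
  by rewrite (label_inj (etrans (esym yi) yj)).
- by move=> xy /eqP <-.
- by move=> /eqP ->.
- by move=> /eqP ->.
Qed.

Canonical glued_equiv := EquivRel glued glued_refl glued_sym glued_trans.

Definition glue_vertex := {eq_quot glued_equiv}.
HB.instance Definition _ := EqQuotient.on glue_vertex.
HB.instance Definition _ := Countable.on glue_vertex.
HB.instance Definition _ :=
  isFinite.Build glue_vertex (pcan_enumP (can_pcan (@reprK _ glue_vertex))).

(* As an edge relation cannot record multiplicities, parallel edges are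
   merged. *)
Definition glue_edge (p q : glue_vertex) : bool :=
  [exists u, exists v,
     [&& p == \pi_glue_vertex u, q == \pi_glue_vertex v & union_edge u v]].

Lemma glue_edge_sym : symmetric glue_edge.
Proof.
suff sub p q : glue_edge p q -> glue_edge q p.
  by move=> p q; apply/idP/idP; apply: sub.
move=> /existsP[u /existsP[v /and3P[pu qv uv]]].
apply/existsP; exists v; apply/existsP; exists u; rewrite pu qv /=.
by case: u v uv {pu qv} => x [] y //=; rewrite edge_sym.
Qed.

Lemma glue_edge_irrefl : irreflexive glue_edge.
Proof.
move=> p; apply/negbTE/negP => /existsP[u /existsP[v /and3P[/eqP ->]]].
move=> /eqP/eqmodP.
by case: u v => x [] y //= /eqP ->; rewrite edge_irrefl.
Qed.

Definition glue : sgraph := SGraph glue_edge_sym glue_edge_irrefl.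

End Gluing.

Definition equiv_IS (t : nat) (G H : bgraph t) : Prop :=
  exists Delta : int, forall F : bgraph t,
    ((opt_IS (glue G F))%:Z = (opt_IS (glue H F))%:Z + Delta)%R.

Section Signature.
Variables (t : nat) (G : bgraph t).

Definition boundary : {set G} := [set label G i | i in 'I_t].

(* Subsets of the common boundary B = {v_1, ..., v_t} are given by their sets
   of labels. *)
Definition signature_IS (S : {set 'I_t}) : nat :=
  \max_(X : {set G} |
        independent X && (X :&: boundary \subset [set label G i | i in S])) #|X|.

End Signature.

(* Main.v *)
Require Import Defs.
From mathcomp Require Import all_boot all_order all_algebra.
From mathcomp Require Import zify.

(** An independent set of G ⊕ F is a pair of independent sets of G and F that
    meet the boundary in the same label set T, and its size is the sum of the
    sizes minus #|T|.  If the part in G is exchanged for one whose trace is a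
    proper subset of T, the boundary vertices lost on the side of F are exactly
    compensated by the smaller #|T|; hence opt_IS (G ⊕ F) is the maximum of
    signature_IS G T + #|Y| - #|T| over the independent sets Y of F, where T is
    the trace of Y.  Conversely, signature_IS G S is recovered by gluing a graph
    with a pendant neighbour at each boundary vertex outside S: these vertices
    may then be traded for their pendant neighbours. *)

Set Implicit Arguments.
Unset Strict Implicit.
Unset Printing Implicit Defensive.

Local Open Scope quotient_scope.

Lemma independentP (G : sgraph) (X : {set G}) :
  reflect {in X &, forall x y, ~~ edge x y} (independent X).
Proof.
apply: (iffP forall_inP) => [iX x y xX yX|iX x xX].
  by have /forall_inP := iX x xX; apply.
by apply/forall_inP => y yX; apply: iX.
Qed.

Lemma independentS (G : sgraph) (X Y : {set G}) :
  X \subset Y -> independent Y -> independent X.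
Proof.
move=> /subsetP XY /independentP iY; apply/independentP => x y xX yX.
by apply: iY; apply: XY.
Qed.

Lemma independent0 (G : sgraph) : independent (set0 : {set G}).
Proof. by apply/independentP => x y; rewrite inE. Qed.

Lemma leq_opt_IS (G : sgraph) (X : {set G}) : independent X -> #|X| <= opt_IS G.
Proof. exact: leq_bigmax_cond. Qed.

Lemma opt_IS_attained (G : sgraph) :
  exists2 X : {set G}, independent X & opt_IS G = #|X|.
Proof.
have [|X iX eX] := eq_bigmax_cond (A := @independent G) (fun X => #|X|).
  by apply/card_gt0P; exists set0; apply: independent0.
by exists X.
Qed.

Section Trace.
Variables (t : nat) (G : bgraph t).
Implicit Types (X : {set G}) (S T : {set 'I_t}).

(** Recorded as labels rather than vertices, so that traces taken in different graphs can be
    compared directly. *)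
Definition trace X : {set 'I_t} := label G @^-1: X.

Lemma sub_trace X S :
  (X :&: boundary G \subset [set label G i | i in S]) = (trace X \subset S).
Proof.
apply/subsetP/subsetP => sub.
  move=> i; rewrite inE => iX.
  have /sub/imsetP[j jS /label_inj -> //] : label G i \in X :&: boundary G.
  by rewrite inE iX imset_f.
move=> x; rewrite inE => /andP[xX /imsetP[i _ xi]].
by rewrite xi imset_f // sub // inE -xi.
Qed.

Lemma leq_signature_IS X S :
  independent X -> trace X \subset S -> #|X| <= signature_IS G S.
Proof.
by move=> iX XS; apply: leq_bigmax_cond; rewrite iX sub_trace.
Qed.

Lemma signature_IS_attained S :
  exists X, [/\ independent X, trace X \subset S & signature_IS G S = #|X|].
Proof.
have [|X] := eq_bigmax_cond (A := fun X => independent X &&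
    (X :&: boundary G \subset [set label G i | i in S])) (fun X => #|X|).
  by apply/card_gt0P; exists set0; rewrite unfold_in independent0 set0I sub0set.
rewrite unfold_in sub_trace => /andP[iX XS] eX.
by exists X.
Qed.

Lemma trace_setD_label X S : trace (X :\: label G @: S) = trace X :\: S.
Proof.
by apply/setP => i; rewrite !inE mem_imset //; apply: label_inj.
Qed.

(** Deleting the vertices labelled in [T :\: S] from an optimal set for [T] makes it admissible for
    [S] and costs at most one vertex per label. *)
Lemma signature_IS_leD S T :
  signature_IS G T <= signature_IS G S + #|T :\: S|.
Proof.
have [X [iX XT ->]] := signature_IS_attained T.
set R := label G @: (T :\: S).
have cR : #|X :&: R| <= #|T :\: S|.
  by rewrite (leq_trans (subset_leq_card (subsetIr _ _))) // leq_imset_card.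
rewrite -(cardsID R X) addnC leq_add //; apply: leq_signature_IS.
  exact: independentS (subsetDl _ _) iX.
rewrite trace_setD_label; apply/subsetP => i; rewrite !inE negb_and negbK.
by case/andP=> /orP[//|/negP iT] iX'; case: iT; apply: (subsetP XT); rewrite inE.
Qed.

End Trace.

Section Gluing.
Variables (t : nat) (G F : bgraph t).
Implicit Types (X : {set G}) (Y : {set F}) (Z : {set glue G F}).

Definition glue_inl (x : G) : glue G F := \pi_(glue_vertex G F) (inl x).
Definition glue_inr (y : F) : glue G F := \pi_(glue_vertex G F) (inr y).

Lemma glue_inl_inj : injective glue_inl.
Proof. by move=> x x' /eqmodP /eqP. Qed.

Lemma glue_inr_inj : injective glue_inr.
Proof. by move=> y y' /eqmodP /eqP. Qed.

Lemma glue_inlr_eq x y :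
  reflect (exists2 i, x = label G i & y = label F i) (glue_inl x == glue_inr y).
Proof.
by apply: (iffP eqP) => [/eqmodP/same_labelP|/same_labelP xy] //; apply/eqmodP.
Qed.

Lemma glue_label i : glue_inl (label G i) = glue_inr (label F i).
Proof. by apply/eqP/glue_inlr_eq; exists i. Qed.

Lemma glue_cover Z :
  Z = glue_inl @: (glue_inl @^-1: Z) :|: glue_inr @: (glue_inr @^-1: Z).
Proof.
apply/setP => z; rewrite inE; apply/idP/orP => [zZ|[]/imsetP[w]]; last 2 first.
- by rewrite inE => wZ ->.
- by rewrite inE => wZ ->.
have := reprK (z : glue_vertex G F); case: (repr _) => w zw.
  by left; apply/imsetP; exists w; rewrite ?inE /glue_inl zw.
by right; apply/imsetP; exists w; rewrite ?inE /glue_inr zw.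
Qed.

Lemma trace_glue Z : trace (glue_inl @^-1: Z) = trace (glue_inr @^-1: Z).
Proof. by apply/setP => i; rewrite !inE glue_label. Qed.

(** Inclusion-exclusion: the images of the two preimages cover [Z] and overlap exactly in its
    boundary vertices, one per label of the trace. *)
Lemma card_glue Z :
  #|Z| + #|trace (glue_inr @^-1: Z)| = #|glue_inl @^-1: Z| + #|glue_inr @^-1: Z|.
Proof.
rewrite -(card_imset _ glue_inl_inj) -(card_imset (_ @^-1: Z) glue_inr_inj).
rewrite -cardsUI -glue_cover; congr (_ + _).
rewrite -(card_imset _ (inj_comp glue_inr_inj (@label_inj _ F))).
apply: eq_card => z; rewrite [in RHS]inE; apply/imsetP/andP.
  move=> [i]; rewrite !inE => iZ ->; split; apply/imsetP.
    by exists (label G i); rewrite ?inE glue_label.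
  by exists (label F i); rewrite ?inE.
case=> /imsetP[x xZ ->] /imsetP[y]; rewrite inE => yZ /eqP/glue_inlr_eq[i -> yi].
by exists i; rewrite ?inE -?yi //= glue_label.
Qed.

(** Every edge of the gluing comes from an edge inside one of the two sides. *)
Lemma independent_glue Z :
  independent Z =
  independent (glue_inl @^-1: Z) && independent (glue_inr @^-1: Z).
Proof.
apply/independentP/andP => [iZ|[/independentP iX /independentP iY] p q pZ qZ].
  split; apply/independentP => u v; rewrite !inE => uZ vZ;
    apply: contra (iZ _ _ uZ vZ) => uv; apply/existsP.
    by exists (inl u); apply/existsP; exists (inl v); rewrite !eqxx.
  by exists (inr u); apply/existsP; exists (inr v); rewrite !eqxx.
apply/negP => /existsP[u /existsP[v /and3P[/eqP pu /eqP qv]]].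
case: u v pu qv => u [] v //= pu qv.
  by apply/negP; apply: iX; rewrite inE /glue_inl -?pu -?qv.
by apply/negP; apply: iY; rewrite inE /glue_inr -?pu -?qv.
Qed.

(** In the union of the two images, a vertex reached from the other side is a boundary vertex, and
    equal traces put it in both sets already. *)
Lemma glue_join X Y : trace X = trace Y ->
  exists2 Z : {set glue G F}, glue_inl @^-1: Z = X & glue_inr @^-1: Z = Y.
Proof.
move=> /setP XY; exists (glue_inl @: X :|: glue_inr @: Y); apply/setP => w.
  rewrite !inE mem_imset; last exact: glue_inl_inj.
  apply/orP/idP => [[//|/imsetP[y yY /eqP/glue_inlr_eq[i wi yi]]]|]; last by left.
  by have := XY i; rewrite !inE -wi -yi yY.
rewrite !inE mem_imset; last exact: glue_inr_inj.
apply/orP/idP => [[/imsetP[x xX /esym/eqP/glue_inlr_eq[i xi wi]]|//]|]; last by right.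
by have := XY i; rewrite !inE -wi -xi xX.
Qed.

Lemma signature_IS_le_opt_glue Y : independent Y ->
  signature_IS G (trace Y) + #|Y| <= opt_IS (glue G F) + #|trace Y|.
Proof.
move=> iY; have [X [iX XY ->]] := signature_IS_attained G (trace Y).
(* [R] holds the labels met by [Y] but not by the optimal [X]. Dropping them from [Y] makes the
   traces agree; at most [#|R|] vertices are lost, while the overlap shrinks by exactly [#|R|]. *)
pose R := trace Y :\: trace X; pose Y' := Y :\: label F @: R.
have trY' : trace X = trace Y'.
  by rewrite trace_setD_label setDDr setDv set0U; apply/esym/setIidPr.
have iY' : independent Y' := independentS (subsetDl _ _) iY.
have [Z ZX ZY] := glue_join trY'.
have := card_glue Z; rewrite ZX ZY -trY'.
have : #|Z| <= opt_IS (glue G F).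
  by apply: leq_opt_IS; rewrite independent_glue ZX ZY iX.
have : #|Y| <= #|R| + #|Y'|.
  rewrite -(cardsID (label F @: R) Y) leq_add2r.
  by rewrite (leq_trans (subset_leq_card (subsetIr _ _))) // leq_imset_card.
have : #|trace X| + #|R| = #|trace Y|.
  by rewrite -(cardsID (trace X) (trace Y)) (setIidPr XY).
lia.
Qed.

Lemma opt_glue_attained : exists2 Y : {set F}, independent Y &
  opt_IS (glue G F) + #|trace Y| <= signature_IS G (trace Y) + #|Y|.
Proof.
have [Z iZ ->] := opt_IS_attained (glue G F).
move: iZ; rewrite independent_glue => /andP[iX iY].
exists (glue_inr @^-1: Z) => //; rewrite card_glue leq_add2r.
by apply: leq_signature_IS; rewrite // trace_glue.
Qed.

End Gluing.

Section Pendant.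
Variables (t : nat) (S : {set 'I_t}).

(* The vertices [inl i] form the boundary and [inr i] is the vertex attached to
   [inl i], isolated if [i \in S]. *)
Definition pendant_edge (u v : 'I_t + 'I_t) : bool :=
  match u, v with
  | inl i, inr j | inr j, inl i => (i == j) && (i \notin S)
  | _, _ => false
  end.

Lemma pendant_edge_sym : symmetric pendant_edge.
Proof. by case=> i []. Qed.

Lemma pendant_edge_irrefl : irreflexive pendant_edge.
Proof. by case. Qed.

Definition pendant_sgraph : sgraph :=
  SGraph pendant_edge_sym pendant_edge_irrefl.

Lemma pendant_label_inj : injective (inl : 'I_t -> pendant_sgraph).
Proof. by move=> i j []. Qed.

Definition pendant : bgraph t := BGraph pendant_label_inj.

Lemma card_pendant (Y : {set pendant}) :
  #|Y| = #|trace Y| + #|[set i | inr i \in Y]|.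
Proof.
rewrite -!sum1_card big_sumType /=.
by congr (_ + _); apply: eq_bigl => i; rewrite !inE.
Qed.

Lemma opt_glue_pendant (G : bgraph t) :
  opt_IS (glue G pendant) = signature_IS G S + t.
Proof.
apply/eqP; rewrite eqn_leq; apply/andP; split.
  have [Y /independentP iY] := opt_glue_attained G pendant.
  (* Each label counts at most once: outside [S], a boundary vertex and its pendant neighbour are
     adjacent. *)
  have : #|trace Y :\: S| + #|[set i | inr i \in Y]| <= t.
    rewrite -[leqRHS]card_ord -(cardsC (trace Y :\: S)) leq_add2l.
    apply/subset_leq_card/subsetP => i; rewrite !inE => iY2.
    apply/negP => /andP[iS iY1].
    by have := iY _ _ iY1 iY2; rewrite /= eqxx iS.
  have := signature_IS_leD G S (trace Y); have := card_pendant Y.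
  lia.
(* All attached vertices, plus the boundary vertices labelled in [S], whose attached vertices are
   isolated. *)
pose Y : {set pendant} := [set u | if u is inl i then i \in S else true].
have trY : trace Y = S by apply/setP => i; rewrite !inE.
have /(signature_IS_le_opt_glue G) : independent Y.
  apply/independentP => -[] i [] j; rewrite !inE //= => iS jS.
    by rewrite iS andbF.
  by rewrite jS andbF.
have -> : #|Y| = #|S| + t.
  rewrite card_pendant trY; congr (_ + _).
  by rewrite -[RHS]card_ord; apply: eq_card => i; rewrite !inE.
rewrite trY; lia.
Qed.

End Pendant.

Theorem theorem7 (t : nat) (G H : bgraph t) :
  equiv_IS G H <->
  exists c : int, forall S : {set 'I_t},
    ((signature_IS G S)%:Z = (signature_IS H S)%:Z + c)%R.
Proof.
split=> -[c eqc]; exists c.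
  by move=> S; have := eqc (pendant S); rewrite !opt_glue_pendant; lia.
move=> F.
(* A set [Y] optimal for one gluing bounds the other from below, since both formulas share the term
   [#|Y| - #|trace Y|]; the two bounds give equality. *)
have [Y iY] := opt_glue_attained G F; have [Y' iY'] := opt_glue_attained H F.
have := signature_IS_le_opt_glue H iY; have := signature_IS_le_opt_glue G iY'.
have := eqc (trace Y); have := eqc (trace Y'); lia.
Qed.
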